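(* Let $f\in\mathcal T_{\pm}$. For $\lambda$-almost every $y\in\mathbb R$, the level set $L_f(y)=\{x\in[0,1]:f(x)=y\}$ is a finite set.
   Context: Let $\phi(x)=\operatorname{dist}(x,\mathbb Z)$ denote the distance from $x\in\mathbb R$ to the nearest integer. $\mathcal T_{\pm}$ is the collection of all functions (signed Takagi functions) of the form $f(x)=\sum_{n=0}^\infty \frac{r_n}{2^n}\phi(2^nx)$ with $r_n\in\{-1,1\}$ for every $n\ge0$. $\lambda$ denotes Lebesgue measure on $\mathbb R$. *)

(* Defs.v *)
From mathcomp Require Import all_boot all_order all_algebra.
From mathcomp Require Import all_classical all_reals all_analysis.
Import Order.TTheory GRing.Theory Num.Theory.
Import numFieldNormedType.Exports.

Set Implicit Arguments.
Unset Strict Implicit.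
Unset Printing Implicit Defensive.

Local Open Scope classical_set_scope.
Local Open Scope ring_scope.

Definition dist_int (R : realType) (x : R) : R :=
  inf (range (fun m : int => `|x - m%:~R|)).

(* Pointwise convergence to [f x] is part of membership, so no default value
   of [lim] is involved; the series always converges absolutely. *)
Definition signed_takagi (R : realType) : set (R -> R) :=
  [set f | exists2 r : nat -> R,
     (forall n, r n = -1 \/ r n = 1) &
     forall x, series (fun n => r n / 2 ^+ n * dist_int (2 ^+ n * x)) @ \oo
       --> f x].

Definition level_set (R : realType) (f : R -> R) (y : R) : set R :=
  [set x | 0 <= x <= 1 /\ f x = y].

(* Main.v *)
Require Import Defs.
From mathcomp Require Import all_boot all_order all_algebra.
From mathcomp Require Import all_classical all_reals all_analysis.
From mathcomp Require Import measurable_realfun ring lra.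
Import Order.TTheory GRing.Theory Num.Theory.
Import numFieldNormedType.Exports.

Set Implicit Arguments.
Unset Strict Implicit.
Unset Printing Implicit Defensive.

Local Open Scope classical_set_scope.
Local Open Scope ring_scope.

(** The proof follows the slopes of the partial sums of a signed Takagi
    function down the binary tree.  A sign sequence [b] is a sequence of
    booleans, with [r n = (-1) ^+ b n], and [takagi b] is the corresponding
    function.  On each half of [[0, 1]], the function
    [tilted s b t = s * t + takagi b t] is, up to the affine change of variables
    [y |-> 2 * y - const] in the values, a function [tilted s' b' t'] with [b']
    the sequence [b] without its first sign and [s'] one of [s + 1], [s - 1]
    ([tilted_half]).  So the slope performs a simple random walk, and it is
    stopped when it hits 0, where [tilted 0 b = takagi b] reproduces a signed
    Takagi function at a smaller scale.

    Let [infinite_levels b] be the set of the [y] at which the level set of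
    [takagi b] is infinite.  By the symmetry [t |-> 1 - t], a level of [takagi b]
    is infinite exactly when its trace on either half is, and on one of the
    halves the slope is 1 ([finite_level_mirror]).  Hence the measure of
    [infinite_levels b] is at most half that of the set of infinite levels of
    [tilted 1 b'].

    In the other direction, start from the slope 1 and stop at the first
    return to 0. The intervals reached have total length at most 1, by the
    random walk estimate [sum_return_prob_le1], and the values taken on such
    an interval lie in an interval of comparable length. By the Borel-Cantelli
    lemma, almost every [y] is taken on finitely many of them only. On the
    remaining points, those along which the slope stays positive for ever,
    [tilted 1 b] is nondecreasing, and two such points with the same value are
    separated by a dyadic point with this value too, so that the value is
    rational ([never_returns_inj]). Therefore, for almost every [y], an
    infinite level [y] of [tilted 1 b] is inherited from an infinite level in
    one of the stopping intervals ([finite_level_set]), and the measure of the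
    set of such [y] is at most the supremum over [b'] of the measure of
    [infinite_levels b'].

    Combining both bounds, this supremum is at most half of itself, and it is
    finite since [takagi b] is bounded; so it is 0.  The argument is run with
    measurable covers: if every [infinite_levels b] has a measurable cover of
    measure at most [m], then each has one of measure at most [m / 2]
    ([infinite_levels_half]). *)

(** * The distance to the nearest integer *)

Section DistInt.
Context {R : realType}.
Implicit Types (x : R) (m : int).

Lemma dist_int_has_lbound x :
  has_lbound (range (fun m : int => `|x - m%:~R|)).
Proof. by exists 0 => _ [m _ <-]. Qed.

Lemma dist_int_le x m : dist_int x <= `|x - m%:~R|.
Proof. by apply: ge_inf; [exact: dist_int_has_lbound | exists m]. Qed.

Lemma le_dist_int x (c : R) :
  (forall m : int, c <= `|x - m%:~R|) -> c <= dist_int x.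
Proof.
move=> h; apply: lb_le_inf; first by exists `|x - 0%:~R|, 0.
by move=> _ [m _ <-].
Qed.

Lemma dist_int_ge0 x : 0 <= dist_int x.
Proof. exact: le_dist_int. Qed.

Lemma dist_int_le1 x : dist_int x <= 1.
Proof.
apply: (le_trans (dist_int_le x (Num.floor x))).
have := floor_le x; have := floorD1_gt x; rewrite intrD => h1 h2.
by rewrite ger0_norm; lra.
Qed.

Lemma dist_intD x m : dist_int (x + m%:~R) = dist_int x.
Proof.
apply/eqP; rewrite eq_le; apply/andP; split; apply: le_dist_int => k.
  apply: (le_trans (dist_int_le _ (k + m))).
  by rewrite intrD opprD addrACA subrr addr0.
apply: (le_trans (dist_int_le _ (k - m))).
by rewrite intrB opprB addrA.
Qed.

Lemma dist_intN x : dist_int (- x) = dist_int x.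
Proof.
apply/eqP; rewrite eq_le; apply/andP; split; apply: le_dist_int => k.
  by apply: (le_trans (dist_int_le _ (- k))); rewrite intrN -opprD normrN.
by apply: (le_trans (dist_int_le _ (- k))); rewrite intrN -normrN opprD opprK.
Qed.

Lemma dist_int_id x : 0 <= x <= 2^-1 -> dist_int x = x.
Proof.
move=> /andP[x0 x1]; apply/eqP; rewrite eq_le; apply/andP; split.
  by apply: (le_trans (dist_int_le x 0)); rewrite subr0 ger0_norm.
apply: le_dist_int => m; have [m0|m0] := leP m 0.
  have : (m%:~R : R) <= 0 by rewrite lerz0.
  by move=> ?; rewrite ger0_norm; lra.
have : (1 : R) <= m%:~R by rewrite -[1]/(1%:~R) ler_int.
by move=> ?; rewrite ler0_norm; lra.
Qed.

End DistInt.

(** * Signed Takagi functions *)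

Section Takagi.
Context {R : realType}.
Implicit Types (b : nat -> bool) (t x : R).

(** The [n]-th term of a signed Takagi series; [b n] tells whether its sign is
    negative. *)
Definition takagi_term b x (n : nat) : R :=
  (-1) ^+ b n / 2 ^+ n * dist_int (2 ^+ n * x).

(** The signed Takagi function with signs [(-1) ^+ b n]; the series converges
    absolutely at every [x] ([is_cvg_takagi]). *)
Definition takagi b x : R := limn (series (takagi_term b x)).

(** The sign sequence without its first sign. *)
Definition tail_signs b : nat -> bool := fun n => b n.+1.

Lemma takagi_term_le b x n : `|takagi_term b x n| <= geometric 1 2^-1 n.
Proof.
rewrite /takagi_term /= !normrM normrX normrN1 expr1n !mul1r normfV normrX.
rewrite (ger0_norm (dist_int_ge0 _)) ger0_norm// exprVn.
by rewrite ler_piMr ?dist_int_le1// invr_ge0 exprn_ge0.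
Qed.

Lemma half_lt1 : `|2^-1 : R| < 1.
Proof. by rewrite ger0_norm; lra. Qed.

Lemma takagi_term_norm_cvg b x : cvgn [normed series (takagi_term b x)].
Proof.
apply: (@series_le_cvg _ _ (geometric 1 2^-1)) => [n|n|n|].
- exact: normr_ge0.
- by rewrite geometric_ge0 ?invr_ge0.
- exact: takagi_term_le.
- exact: is_cvg_geometric_series half_lt1.
Qed.

Lemma is_cvg_takagi b x : cvgn (series (takagi_term b x)).
Proof. exact: normed_cvg (@takagi_term_norm_cvg b x). Qed.

Lemma takagi_bound b x : `|takagi b x| <= 2.
Proof.
apply: (le_trans (lim_series_norm (@takagi_term_norm_cvg b x))).
apply: (le_trans (lim_series_le (@takagi_term_norm_cvg b x)
  (is_cvg_geometric_series (a := 1) half_lt1) (takagi_term_le b x))).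
rewrite (cvg_lim _ (cvg_geometric_series (a := 1) half_lt1))//.
by rewrite mul1r (_ : 1 - 2^-1 = 2^-1) ?invrK//; lra.
Qed.

Lemma takagi_sym b x : takagi b (1 - x) = takagi b x.
Proof.
rewrite /takagi; congr (limn (series _)); apply/funext => n.
rewrite /takagi_term; congr (_ * _).
have -> : 2 ^+ n * (1 - x) = - (2 ^+ n * x) + (2 ^+ n)%:~R.
  by rewrite mulrBr mulr1 addrC rmorphXn.
by rewrite dist_intD dist_intN.
Qed.

(** Self-affinity on the left half; [takagi_sym] gives it on the right half. *)
Lemma takagi_half b t : 0 <= t <= 1 ->
  takagi b (t / 2) = ((-1) ^+ b 0%N * t + takagi (tail_signs b) t) / 2.
Proof.
move=> t01; rewrite {1}/takagi; apply: cvg_lim => //.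
rewrite -(cvg_shiftS (series _)) /=.
have -> : (fun n => series (takagi_term b (t / 2)) n.+1) =
    (fun n => (-1) ^+ b 0%N * t / 2 +
              series (takagi_term (tail_signs b) t) n / 2).
  apply/funext => n; rewrite /series /= big_nat_recl// {1}/takagi_term.
  rewrite !expr0 invr1 mul1r mulr1 dist_int_id; last by lra.
  rewrite mulrA mulr_suml; congr (_ + _); apply: eq_bigr => i _.
  rewrite /takagi_term /tail_signs exprS.
  have -> : 2 * 2 ^+ i * (t / 2) = 2 ^+ i * t by field.
  by rewrite invfM; ring.
rewrite mulrDl; apply: cvgD; first exact: cvg_cst.
by apply: cvgM; [exact: is_cvg_takagi | exact: cvg_cst].
Qed.

End Takagi.

(** * Descent along the binary tree *)

Section Descent.
Context {R : realType}.
Implicit Types (b : nat -> bool) (t y : R) (s : nat) (c : bool).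

(** A signed Takagi function plus the linear function of slope [s]. *)
Definition tilted s b t : R := s%:R * t + takagi b t.

(** The slope one level down, where [c] says whether it decreases; the slopes are
    natural numbers, and [step] is only used at positive ones. *)
Definition step c s : nat := if c then s.-1 else s.+1.

(** Twice the value of [tilted s b] at the left end point of the half [c]
    ([false] for left, [true] for right): the values [y] of [tilted s b] on this
    half are the [y] for which [2 * y - offset c s b] is a value one level down. *)
Definition offset c s b : R := if c then s%:R + (-1) ^+ b 0%N else 0.

Lemma tilted0 b : tilted 0 b = takagi b.
Proof. by apply/funext => t; rewrite /tilted mul0r add0r. Qed.

Lemma natr_step c s : (0 < s)%N -> (step c s)%:R = s%:R + (-1) ^+ c :> R.
Proof.
case: s => // s _; case: c; rewrite /step /= ?expr0 ?expr1 -!natr1; lra.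
Qed.

(** Self-affinity on the half [c]. *)
Lemma takagi_children c b t : c%:R <= 2 * t <= c%:R + 1 ->
  takagi b t = ((-1) ^+ b 0%N * (if c then 2 - 2 * t else 2 * t) +
                takagi (tail_signs b) (2 * t - c%:R)) / 2.
Proof.
case: c => /= /andP[h1 h2].
  have -> : takagi b t = takagi b ((2 - 2 * t) / 2).
    by rewrite -takagi_sym; congr takagi; field.
  rewrite takagi_half; last by apply/andP; split; lra.
  rewrite -(takagi_sym (tail_signs b) (2 * t - 1)).
  by have -> : 1 - (2 * t - 1) = 2 - 2 * t by ring.
have -> : takagi b t = takagi b ((2 * t) / 2) by congr takagi; field.
by rewrite takagi_half ?subr0//; apply/andP; split; lra.
Qed.

(** On the half [c], the slope decreases exactly when the first sign is negative
    or the half is the right one, but not both. *)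
Lemma tilted_half c s b t : (0 < s)%N -> c%:R <= 2 * t <= c%:R + 1 ->
  2 * tilted s b t - offset c s b =
  tilted (step (b 0%N (+) c) s) (tail_signs b) (2 * t - c%:R).
Proof.
move=> s0 ht; rewrite /tilted /offset natr_step// signr_addb.
have := takagi_children b ht.
by case: c {ht} => /= ->; rewrite ?expr0 ?expr1; field.
Qed.

(** The union, over the dyadic subintervals of generation [n] in which the slope
    started at [s] reaches 0 for the first time, of the affine copies of
    [A b'], for [b'] the remaining signs.  The copies lie in the space of values:
    when [A b'] is the range of [takagi b'], they are the ranges of [tilted s b]
    on these subintervals. *)
Fixpoint return_set (A : (nat -> bool) -> set R) n s b : set R :=
  match n, s with
  | 0, 0 => A b
  | n'.+1, _.+1 => [set y | exists c,
      return_set A n' (step (b 0%N (+) c) s) (tail_signs b)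
        (2 * y - offset c s b)]
  | _, _ => set0
  end.

(** The value [y] avoids all the intervals of values attached to the first returns
    of the slope to 0; [[-2, 2]] contains the range of every [takagi b].  In
    particular the slope stays positive along each [t] with
    [tilted s b t = y]. *)
Definition never_returns s b y :=
  forall n, ~ return_set (fun=> `[-2, 2]%classic) n s b y.

Lemma never_returns_half c s b y : never_returns s b y -> (0 < s)%N ->
  never_returns (step (b 0%N (+) c) s) (tail_signs b) (2 * y - offset c s b).
Proof. by case: s => // s h _ n hn; apply: (h n.+1); exists c. Qed.

Lemma never_returns_gt0 s b t : never_returns s b (tilted s b t) -> (0 < s)%N.
Proof.
case: s => // /(_ 0%N) /= []; rewrite tilted0 in_itv /= -ler_norml.
exact: takagi_bound.
Qed.

Lemma half_cover t : 0 <= t <= 1 -> exists c : bool, c%:R <= 2 * t <= c%:R + 1.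
Proof.
by move=> ht; have [h|h] := leP t 2^-1; [exists false|exists true] => /=; lra.
Qed.

Lemma le0_dyadic (x a : R) : (forall n, x <= a / 2 ^+ n) -> x <= 0.
Proof.
move=> h; have cv : (fun n => a / 2 ^+ n) @ \oo --> (0 : R).
  have := cvg_geometric a (@half_lt1 R); apply: cvg_trans.
  by apply: near_eq_cvg; apply: nearW => n /=; rewrite exprVn.
rewrite -(cvg_lim _ cv)//; apply: limr_ge; first by apply/cvg_ex; exists 0.
exact: nearW.
Qed.

(** A value that avoids the first returns lies between the values at the end
    points 0 and 1, which are 0 and [s].  Going one level down halves the error of
    the rough bound by [2], as the slope is still positive. *)
Lemma never_returns_bound_dyadic n s b t : 0 <= t <= 1 ->
  never_returns s b (tilted s b t) ->
  - (2 / 2 ^+ n) <= tilted s b t <= s%:R + 2 / 2 ^+ n.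
Proof.
elim: n s b t => [|n IH] s b t ht hy.
  have := takagi_bound b t; rewrite ler_norml expr0 divr1 /tilted.
  have : 0 <= s%:R * t <= s%:R.
    by case/andP: ht => t0 t1; rewrite mulr_ge0//= ler_piMr.
  lra.
have s0 := never_returns_gt0 hy.
have s1 : 1 <= s%:R :> R by rewrite ler1n.
have [c hc] := half_cover ht.
have := never_returns_half (c := c) hy s0; rewrite tilted_half// => /IH.
have /[swap]/[apply] : 0 <= 2 * t - c%:R <= 1 by lra.
rewrite -tilted_half// natr_step// signr_addb /offset.
have -> : 2 / 2 ^+ n.+1 = (2 / 2 ^+ n) / 2 :> R.
  by rewrite exprS invfM; ring.
by case: (b 0%N); case: c {hc}; rewrite /= ?expr0 ?expr1; lra.
Qed.

Lemma never_returns_bound s b t : 0 <= t <= 1 ->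
  never_returns s b (tilted s b t) -> 0 <= tilted s b t <= s%:R.
Proof.
move=> ht hy.
have h n := never_returns_bound_dyadic n ht hy.
apply/andP; split.
  rewrite -oppr_le0; apply: (@le0_dyadic _ 2) => n.
  by have /andP[] := h n; lra.
rewrite -subr_le0; apply: (@le0_dyadic _ 2) => n.
by have /andP[] := h n; lra.
Qed.

Definition rational : set R := range ratr.

Lemma rational_half c s b y : rational (2 * y - offset c s b) -> rational y.
Proof.
move=> [q _ hq].
exists ((q + if c then s%:R + (-1) ^+ b 0%N else 0) / 2) => //.
rewrite [RHS](_ : y = ((2 * y - offset c s b) + offset c s b) / 2); last by field.
rewrite -hq fmorph_div rmorphD /= ratr_nat; congr ((_ + _) / _).
by rewrite /offset; case: c {hq};
  rewrite ?rmorph0// rmorphD/= ratr_nat rmorph_sign.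
Qed.

(** Two points with the same irrational value that avoids the first returns follow
    the same path: if the midpoint separated them, monotonicity would force their
    value to be the value at the midpoint, which is rational. *)
Lemma never_returns_dist n s b t0 t1 : 0 <= t0 -> t0 <= t1 -> t1 <= 1 ->
  tilted s b t0 = tilted s b t1 -> never_returns s b (tilted s b t1) ->
  ~ rational (tilted s b t1) -> t1 - t0 <= 1 / 2 ^+ n.
Proof.
elim: n s b t0 t1 => [|n IH] s b t0 t1 h0 h01 h1 e hy hQ.
  by rewrite expr0; lra.
have s0 := never_returns_gt0 hy.
have half c : c%:R <= 2 * t0 -> 2 * t1 <= c%:R + 1 -> t1 - t0 <= 1 / 2 ^+ n.+1.
  move=> k0 k1.
  suff : (2 * t1 - c%:R) - (2 * t0 - c%:R) <= 1 / 2 ^+ n.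
    have -> : 1 / 2 ^+ n.+1 = (1 / 2 ^+ n) / 2 :> R.
      by rewrite exprS invfM; ring.
    lra.
  apply: (IH (step (b 0%N (+) c) s) (tail_signs b)); try lra.
  - by rewrite -!tilted_half//; [rewrite e | lra | lra].
  - by rewrite -tilted_half//; [exact: never_returns_half | lra].
  - by rewrite -tilted_half//; [move/rational_half | lra].
have [k1|k1] := leP t1 2^-1; first by apply: (half false) => /=; lra.
have [k0|k0] := leP 2^-1 t0; first by apply: (half true) => /=; lra.
(* The midpoint lies strictly between the two points. *)
have c0 : (false%:R : R) <= 2 * t0 <= false%:R + 1 by rewrite /=; lra.
have c1 : (true%:R : R) <= 2 * t1 <= true%:R + 1 by rewrite /=; lra.
have := never_returns_half (c := false) hy s0; rewrite -{1}e tilted_half//.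
move=> /never_returns_bound; rewrite -tilted_half//.
have := never_returns_half (c := true) hy s0; rewrite tilted_half//.
move=> /never_returns_bound; rewrite -tilted_half//.
move: c0 c1; rewrite e !natr_step// addbF addbT signrN /offset /= => c0 c1.
move=> /(_ ltac:(lra)) b1 /(_ ltac:(lra)) b0.
case: hQ; exists ((s%:R + (-1) ^+ b 0%N) / 2) => //.
rewrite fmorph_div rmorphD /= !ratr_nat rmorph_sign.
by apply/eqP; rewrite eq_le; apply/andP; split; lra.
Qed.

Lemma never_returns_inj s b t0 t1 : 0 <= t0 <= 1 -> 0 <= t1 <= 1 ->
  tilted s b t0 = tilted s b t1 -> never_returns s b (tilted s b t1) ->
  ~ rational (tilted s b t1) -> t0 = t1.
Proof.
wlog h01 : t0 t1 / t0 <= t1.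
  move=> W h0 h1 e hy hQ; have [h|h] := leP t0 t1; first exact: W.
  by apply/esym/W; rewrite ?e// ltW.
move=> h0 h1 e hy hQ; apply/eqP; rewrite eq_le h01 -subr_le0.
by apply: (@le0_dyadic _ 1) => n; apply: (never_returns_dist n _ _ _ e) => //; lra.
Qed.

Lemma sub_return_set (A B : (nat -> bool) -> set R) n s b :
  (forall b', A b' `<=` B b') -> return_set A n s b `<=` return_set B n s b.
Proof.
move=> AB; elim: n s b => [|n IH] [|s] b;
  [exact: AB | exact: subset_refl | exact: subset_refl | ].
by move=> y [c hc]; exists c; exact: IH.
Qed.

(** The levels at which [takagi b] has an infinite level set in [[0, 1]]. *)
Definition infinite_levels b : set R :=
  [set y | ~ finite_set (level_set (takagi b) y)].

(** A level set is finite if its value is irrational, is taken on no first-return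
    interval from generation [N] on, and is taken finitely often on each
    first-return interval. *)
Lemma finite_level_set N s b y :
  (forall n, (N <= n)%N -> ~ return_set (fun=> `[-2, 2]%classic) n s b y) ->
  (forall n, ~ return_set infinite_levels n s b y) ->
  ~ rational y -> finite_set (level_set (tilted s b) y).
Proof.
elim: N s b y => [|N IH] s b y hJ hF hQ.
  (* No returns at all: there is at most one point. *)
  have [[t [ht hy]]|h] := pselect (level_set (tilted s b) y !=set0).
    apply: (@sub_finite_set _ _ [set t]); last exact: finite_set1.
    move=> u [hu yu] /=; apply: (@never_returns_inj s b) => //.
    - by rewrite yu hy.
    - by rewrite hy => n; exact: hJ.
    - by rewrite hy.
  rewrite (_ : level_set _ _ = set0); first exact: finite_set0.
  by apply/seteqP; split => // t ht; apply: h; exists t.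
case: s hJ hF => [|s] hJ hF.
  by rewrite tilted0; apply: contrapT; exact: (hF 0%N).
pose L c := level_set (tilted (step (b 0%N (+) c) s.+1) (tail_signs b))
  (2 * y - offset c s.+1 b).
have Lfin c : finite_set (L c).
  apply: IH => [n Nn hn|n hn|/rational_half//].
    by apply: (hJ n.+1 Nn); exists c.
  by apply: (hF n.+1); exists c.
apply: (@sub_finite_set _ _ ((fun u => (u + false%:R) / 2) @` L false `|`
                             (fun u => (u + true%:R) / 2) @` L true)).
  move=> t [ht yt]; have [c hc] := half_cover ht.
  have mem : L c (2 * t - c%:R).
    by split; [lra | rewrite -yt tilted_half].
  have img : (2 * t - c%:R + c%:R) / 2 = t by field.
  by case: c hc mem img => hc mem img; [right|left];
    [exists (2 * t - true%:R) | exists (2 * t - false%:R)].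
by rewrite finite_setU; split; exact: finite_image.
Qed.

(** The half [b 0] of [[0, 1]] is the one on which [takagi b] starts with slope 1,
    and the reflection [t |-> 1 - t] maps the rest of the level set into it. *)
Lemma finite_level_mirror b y :
  finite_set (level_set (tilted 1 (tail_signs b)) (2 * y + (b 0%N)%:R)) ->
  finite_set (level_set (takagi b) y).
Proof.
set c := b 0%N; set L := level_set _ _ => fL.
apply: (@sub_finite_set _ _ ((fun u => (u + c%:R) / 2) @` L `|`
                             (fun u => 1 - (u + c%:R) / 2) @` L)); last first.
  by rewrite finite_setU; split; exact: finite_image.
have half t : c%:R <= 2 * t <= c%:R + 1 -> takagi b t = y ->
    L (2 * t - c%:R).
  move=> ht yt; split; first by lra.
  rewrite -yt (takagi_children b ht) -/c /tilted mul1r.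
  by case: (c); rewrite /= ?expr0 ?expr1; field.
move=> t [ht yt]; have [d hd] := half_cover ht.
have [e|e] := eqVneq d c.
  left; exists (2 * t - c%:R); first by apply: half; rewrite -?e.
  by field.
right; exists (2 * (1 - t) - c%:R); last by field.
apply: half; last by rewrite takagi_sym.
by case: d c {fL L} hd e => [] [] //=; lra.
Qed.

End Descent.

(** * Measure of the infinite levels *)

Section Measure.
Context {R : realType}.
Implicit Types (b : nat -> bool) (a y c : R) (s n : nat).

Notation mu := (@lebesgue_measure R).

Lemma measurable_fun_affine a :
  measurable_fun setT
    ((fun y => 2 * y - a) : measurableTypeR R -> measurableTypeR R).
Proof.
by apply: (@measurable_funB _ (measurableTypeR R) R setT ( *%R 2) (cst a)) => //.
Qed.

Lemma measurable_preimage_affine a (A : set (measurableTypeR R)) :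
  measurable A -> measurable ([set y | A (2 * y - a)] : set (measurableTypeR R)).
Proof.
by move=> mA; rewrite -[X in measurable X]setTI; exact: measurable_fun_affine.
Qed.

(** The proof compares Lebesgue measure with twice its image under
    [y |-> 2 * y - a]; the two agree on half-open intervals. *)
Lemma lebesgue_measure_preimage_affine a (A : set (measurableTypeR R)) :
  measurable A -> mu [set y | A (2 * y - a)] = (2^-1%:E * mu A)%E.
Proof.
move=> mA; pose f : measurableTypeR R -> measurableTypeR R := fun y => 2 * y - a.
have mf : measurable_fun setT f := measurable_fun_affine a.
have -> : mu A = (2%:E * pushforward mu f A)%E.
  apply: (@lebesgue_measure_unique R
    (mscale (NngNum (ler0n R 2)) (pushforward mu f))) => //= _ [[u v]] _ <-.
  rewrite /mscale /= /pushforward.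
  have -> : f @^-1` `]u, v]%classic = `](u + a) / 2, (v + a) / 2]%classic.
    by apply/seteqP; rewrite /f; split => x /=; rewrite !in_itv/= => /andP[? ?];
      apply/andP; split; lra.
  rewrite !lebesgue_measure_itv/= !lte_fin ltr_pM2r ?invr_gt0// ltrD2r.
  case: ifPn => _; last by rewrite mule0.
  by rewrite -!EFinD -EFinM; congr EFin; lra.
by rewrite /pushforward muleA -EFinM mulVf// mul1e.
Qed.

(** The probability that a simple random walk started at [s] hits 0 for the first
    time at time [n]. *)
Fixpoint return_prob n s : R :=
  match n, s with
  | 0, 0 => 1
  | n'.+1, s'.+1 => (return_prob n' s' + return_prob n' s'.+2) / 2
  | _, _ => 0
  end.

Lemma sum_return_prob_le1 N s : \sum_(n < N) return_prob n s <= 1.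
Proof.
elim: N s => [|N IH] s; first by rewrite big_ord0.
rewrite big_ord_recl /=; case: s => [|s].
  by rewrite big1 ?addr0.
rewrite add0r -mulr_suml big_split /=.
by have := IH s; have := IH s.+2; lra.
Qed.

Section ReturnSet.
Variables (A : (nat -> bool) -> set R) (m : R).
Hypothesis mA : forall b, measurable (A b : set (measurableTypeR R)).
Hypothesis muA : forall b, (mu (A b) <= m%:E)%E.

Let return_setS n s b : return_set A n.+1 s.+1 b =
  [set y | return_set A n (step (b 0%N) s.+1) (tail_signs b)
             (2 * y - offset false s.+1 b)] `|`
  [set y | return_set A n (step (~~ b 0%N) s.+1) (tail_signs b)
             (2 * y - offset true s.+1 b)].
Proof.
apply/seteqP; split => y.
  by move=> [[]]; [right; rewrite /= -addbT|left; rewrite /= -(addbF (b 0%N))].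
by move=> [h|h]; [exists false; rewrite addbF | exists true; rewrite addbT].
Qed.

Lemma measurable_return_set n s b :
  measurable (return_set A n s b : set (measurableTypeR R)).
Proof.
elim: n s b => [|n IH] [|s] b;
  [exact: mA | exact: measurable0 | exact: measurable0 | ].
rewrite return_setS; apply: measurableU;
  by apply: measurable_preimage_affine; exact: IH.
Qed.

Lemma return_set_le n s b :
  (mu (return_set A n s b) <= (return_prob n s * m)%:E)%E.
Proof.
elim: n s b => [|n IH] [|s] b; rewrite ?mul0r ?measure0//.
  by rewrite mul1r; exact: muA.
rewrite return_setS.
have mI c s' : measurable ([set y | return_set A n s' (tail_signs b)
    (2 * y - c)] : set (measurableTypeR R)).
  by apply: measurable_preimage_affine; exact: measurable_return_set.
apply: (le_trans (measureU2 _ (mI _ _) (mI _ _))).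
rewrite /= !lebesgue_measure_preimage_affine; try exact: measurable_return_set.
have h s' : (2^-1%:E * mu (return_set A n s' (tail_signs b)) <=
    (2^-1 * (return_prob n s' * m))%:E)%E.
  by rewrite EFinM lee_pmul2l// lte_fin invr_gt0.
apply: (le_trans (leeD (h _) (h _))); rewrite -EFinD lee_fin.
by rewrite /step; case: (b 0%N) => /=; lra.
Qed.

Lemma sum_return_set_le s b : (\sum_(n <oo) mu (return_set A n s b) <= m%:E)%E.
Proof.
have m0 : 0 <= m by rewrite -lee_fin (le_trans _ (muA b)).
apply: lime_le; first exact: is_cvg_nneseries.
apply: nearW => N.
apply: (@le_trans _ _ (\sum_(0 <= n < N) (return_prob n s * m)%:E)%E).
  by apply: lee_sum => n _; exact: return_set_le.
rewrite sumEFin lee_fin big_mkord -mulr_suml ler_piMl//.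
exact: sum_return_prob_le1.
Qed.

End ReturnSet.

(** [E] has a measurable cover of measure at most [m]; [E] itself need not be
    measurable. *)
Definition has_cover_le (E : set R) (m : R) := exists A : set (measurableTypeR R),
  [/\ measurable A, (mu A <= m%:E)%E & E `<=` A].

Lemma countable_rational : countable (rational : set R).
Proof. exact: card_le_trans (card_image_le _ _) (countableP _). Qed.

(** From slope 1, the bad levels are covered by the copies of the covers [A b'] at
    the first returns, the levels met by infinitely many first-return intervals,
    and the rationals; the last two sets are null. *)
Lemma infinite_levels_tilted1 m :
  (forall b, has_cover_le (infinite_levels b) m) ->
  forall b, has_cover_le [set y | ~ finite_set (level_set (tilted 1 b) y)] m.
Proof.
move=> /choice[A hA] b.
have mA b' : measurable (A b') by have [] := hA b'.
have muA b' : (mu (A b') <= m%:E)%E by have [] := hA b'.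
pose J b' : set (measurableTypeR R) := `[-2, 2]%classic.
have mJ b' : measurable (J b') by exact: measurable_itv.
have muJ b' : (mu (J b') <= 4%:E)%E.
  rewrite lebesgue_measure_itv/= lte_fin; case: ifPn => _; last by rewrite lee_fin.
  by rewrite -?EFinN -?EFinD lee_fin; lra.
pose W n := return_set A n 1 b : set (measurableTypeR R).
pose V n := return_set J n 1 b : set (measurableTypeR R).
have mW n : measurable (W n) by exact: measurable_return_set.
have mV n : measurable (V n) by exact: measurable_return_set.
have mbW : measurable (\bigcup_n W n) by exact: bigcup_measurable.
have V0 : mu (lim_sup_set V) = 0%E.
  apply: lim_sup_set_cvg0 => //.
  by apply: (le_lt_trans (sum_return_set_le mJ muJ 1 b)); rewrite ltry.
have mlV : measurable (lim_sup_set V).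
  by apply: bigcap_measurable => // k _; exact: bigcup_measurable.
have mQ : measurable (rational : set (measurableTypeR R)).
  by apply: countable_measurable => //; exact: countable_rational.
exists (\bigcup_n W n `|` (lim_sup_set V `|` rational)); split.
- by apply: measurableU => //; exact: measurableU.
- have null : mu (lim_sup_set V `|` rational) = 0%E.
    apply/eqP; rewrite -measure_le0; apply: (le_trans (measureU2 _ _ _)) => //=.
    by rewrite V0 lebesgue_measure_rat adde0.
  apply: (le_trans (measureU2 _ _ _)) => //=; first exact: measurableU.
  rewrite null adde0.
  apply: (le_trans (measure_sigma_subadditive _ mW mbW _)) => //.
  exact: sum_return_set_le.
- move=> y hy; apply: contrapT => hn; apply: hy.
  have [N hN] : exists N, forall n, (N <= n)%N -> ~ V n y.
    apply: contrapT => h; apply: hn; right; left => N _.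
    by apply: contrapT => h'; apply: h; exists N => n Nn hV; apply: h'; exists n.
  apply: (@finite_level_set _ N) => //.
    move=> n hW; apply: hn; left; exists n => //.
    by move: hW; apply: sub_return_set => b'; have [] := hA b'.
  by move=> hQ; apply: hn; right; right.
Qed.

Lemma infinite_levels_half m :
  (forall b, has_cover_le (infinite_levels b) m) ->
  forall b, has_cover_le (infinite_levels b) (m / 2).
Proof.
move=> h b.
have [A [mA muA hA]] := infinite_levels_tilted1 h (tail_signs b).
exists [set y | A (2 * y - - (b 0%N)%:R)]; split.
- exact: measurable_preimage_affine.
- rewrite lebesgue_measure_preimage_affine// mulrC EFinM.
  by rewrite lee_pmul2l// lte_fin invr_gt0.
- move=> y hy; apply: hA => /=; rewrite opprK => hf; apply: hy.
  exact: finite_level_mirror.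
Qed.

(** The initial cover, of measure 4, is the interval [[-2, 2]]: no other value is
    taken at all. *)
Lemma infinite_levels_bound b k : has_cover_le (infinite_levels b) (4 / 2 ^+ k).
Proof.
elim: k b => [|k IH] b; last first.
  by rewrite exprSr invfM mulrA; exact: infinite_levels_half.
exists `[-2, 2]%classic; split; first exact: measurable_itv.
  rewrite expr0 divr1 lebesgue_measure_itv/= lte_fin.
  by case: ifPn => _; rewrite -?EFinN -?EFinD lee_fin; lra.
move=> y hy; apply: contrapT => hn; apply: hy.
rewrite (_ : level_set _ _ = set0); first exact: finite_set0.
apply/seteqP; split => // t [_ ht]; apply: hn; rewrite /= in_itv /= -ler_norml -ht.
exact: takagi_bound.
Qed.

Lemma infinite_levels_negligible b : mu.-negligible (infinite_levels b).
Proof.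
have /choice[A hA] := infinite_levels_bound b.
have mA k : measurable (A k) by have [] := hA k.
exists (\bigcap_k A k); split.
- exact: bigcap_measurable.
- have le k : (mu (\bigcap_k A k) <= (4 / 2 ^+ k)%:E)%E.
    have [_ muA _] := hA k; apply: le_trans muA.
    by rewrite le_measure ?inE//; [exact: bigcap_measurable | exact: bigcap_inf].
  have fin : mu (\bigcap_k A k) \is a fin_num.
    by rewrite ge0_fin_numE ?(le_lt_trans (le 0%N)) ?ltry.
  suff : fine (mu (\bigcap_k A k)) <= 0.
    by rewrite -lee_fin fineK// measure_le0 => /eqP.
  by apply: (@le0_dyadic R _ 4) => k; rewrite -lee_fin fineK.
- by move=> y hy k _; have [_ _] := hA k; exact.
Qed.

End Measure.

Unset Implicit Arguments.
Set Strict Implicit.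
Set Printing Implicit Defensive.

Theorem theorem1p2 (R : realType) (f : R -> R) (hf : signed_takagi f) :
  {ae @lebesgue_measure R, forall y : R, finite_set (level_set f y)}.
Proof.
have [r rE fE] := hf; pose b n := r n == -1.
have -> : f = takagi b.
  apply/funext => x; rewrite /takagi -(cvg_lim _ (fE x))//.
  congr (limn (series _)); apply/funext => n; rewrite /takagi_term /b.
  have : (1 : R) != -1 by apply/eqP; lra.
  by case: (rE n) => -> h; rewrite ?eqxx ?expr1 ?(negbTE h).
exact: infinite_levels_negligible.
Qed.
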